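(* Let $p$ be a prime, and let $n\in\mathbb N$ and $r\in\mathbb Z$. Set $n^*=\{-n\}_{p-1}$. Let $m$ be any integer with $m\equiv n\pmod p$. If $m\ge 0$, then $$\sum_{k=0}^{n^*}\bar S(n^*-k+m,m)\frac{(-r)^k}{k!}=\sum_{k=0}^{n^*}\bar S(m+n^*,m+k)\binom{-r}{k}=\sum_{k=0}^m\binom mk(-1)^{m-k}\frac{(k-r)^{m+n^*}}{(m+n^* )!},$$ and $(-1)^nF_p(n,r)$ is congruent modulo $p$ to this common value. If $m\le 0$, then $$F_p(n,r)\equiv\frac{(-1)^{n^*}}{n^*!}B_{n^*}^{(-m)}(-r)\equiv-(p-1-n^* )!\,B_{n^*}^{(-m)}(-r)\pmod p.$$
   Context: $\mathbb N=\{0,1,2,\ldots\}$. For $a\in\mathbb Z$ and a positive integer $m$, $\{a\}_m$ denotes the least nonnegative residue of $a$ modulo $m$. For a prime $p$, $n\in\mathbb N$ and $r\in\mathbb Z$, put $C_p(n,r)=\sum_{0\le k\le n,\ k\equiv r\,(\mathrm{mod}\ p)}\binom nk(-1)^k$. The Fleck quotient is $$F_p(n,r)=(-p)^{-\lfloor(n-1)/(p-1)\rfloor}C_p(n,r)+[\![n=0]\!],$$ where $[\![A]\!]$ is $1$ if the assertion $A$ holds and $0$ otherwise; it is an integer (Fleck). Let $(x)_0=1$ and $(x)_k=x(x-1)\cdots(x-k+1)$ for $k\ge1$; $\binom{x}{k}=(x)_k/k!$. The Stirling numbers of the second kind $S(n,k)$ ($n,k\in\mathbb N$) are given by $x^n=\sum_{k\in\mathbb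 N}S(n,k)(x)_k$, and $\bar S(n,k)=\frac{k!}{n!}S(n,k)$. For $m\in\mathbb N$ the $m$-th order Bernoulli polynomials $B_n^{(m)}(t)$ are defined by $$\frac{x^me^{tx}}{(e^x-1)^m}=\sum_{n=0}^\infty B_n^{(m)}(t)\frac{x^n}{n!}.$$ Convention: $0^0=1$. Congruences modulo $p$ between rational numbers are understood in the ring $\mathbb Z_p$ of $p$-adic integers, i.e. $x\equiv y\pmod p$ means $x-y\in p\mathbb Z_p$. *)

(* Defs.v *)
From mathcomp Require Import all_boot all_order all_algebra.

Set Implicit Arguments.
Unset Strict Implicit.
Unset Printing Implicit Defensive.

Import Order.TTheory GRing.Theory Num.Theory.
Local Open Scope ring_scope.

Definition lres (a : int) (m : nat) : nat := `|(a %% m%:Z)%Z|%N.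

(* [Z_p] meets [rat] in the rationals whose reduced denominator is prime to
   [p]; a rational lies in [p Z_p] iff it is [p] times such a rational. *)
Definition padic_integral (p : nat) (x : rat) : bool := ~~ (p%:Z %| denq x)%Z.

Definition congr_mod (p : nat) (x y : rat) : Prop :=
  exists2 z : rat, padic_integral p z & x - y = p%:R * z.

Definition fleck_sum (p n : nat) (r : int) : int :=
  \sum_(k < n.+1 | (k%:Z == r %[mod p%:Z])%Z) 'C(n, k)%:R * (-1) ^+ k.

(* The exponent is an [int]: [intdiv]'s quotient by a positive integer is the
   floor, so it equals [-1] at [n = 0]. *)
Definition fleck_quotient (p n : nat) (r : int) : rat :=
  (- p%:R) ^ (- ((n%:Z - 1) %/ (p%:Z - 1))%Z) * (fleck_sum p n r)%:~R
  + (n == 0%N)%:R.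

Definition falling (R : pzRingType) (x : R) (k : nat) : R :=
  \prod_(i < k) (x - i%:R).

Definition binom (x : rat) (k : nat) : rat := falling x k / k`!%:R.

(* A finitely supported family [s_k] is encoded as a polynomial [s]; this is
   the polynomial [\sum_k s_k (x)_k]. *)
Definition falling_comb (s : {poly rat}) : {poly rat} :=
  \sum_(k < size s) s`_k *: falling 'X k.

Lemma falling_comb_widen (N : nat) (s : {poly rat}) : (size s <= N)%N ->
  falling_comb s = \sum_(k < N) s`_k *: falling 'X k.
Proof.
move=> sN; rewrite /falling_comb (big_ord_widen _ (fun k => s`_k *: falling 'X k) sN).
rewrite big_mkcond; apply: eq_bigr => k _; case: ltnP => // sk.
by rewrite nth_default // scale0r.
Qed.

Lemma falling_combB (s t : {poly rat}) :
  falling_comb (s - t) = falling_comb s - falling_comb t.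
Proof.
pose N := maxn (size (s - t)) (maxn (size s) (size t)).
rewrite !(@falling_comb_widen N) ?leq_max ?leqnn ?orbT // -sumrB.
by apply: eq_bigr => k _; rewrite coefB scalerBl.
Qed.

Lemma size_falling (k : nat) : size (falling ('X : {poly rat}) k) = k.+1.
Proof.
elim: k => [|k IHk]; first by rewrite /falling big_ord0 size_poly1.
have -> : falling ('X : {poly rat}) k.+1 = falling 'X k * ('X - k%:R%:P).
  by rewrite /falling big_ord_recr /= polyC_natr.
by rewrite size_Mmonic ?monicXsubC ?size_XsubC ?IHk ?addn2 // -size_poly_eq0 IHk.
Qed.

Lemma falling_comb_inj : injective falling_comb.
Proof.
move=> s t /eqP; rewrite -subr_eq0 -falling_combB => /eqP st0.
apply/eqP; rewrite -subr_eq0; apply: contra_eqT st0; move: (s - t) => u u0.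
have: size u != 0%N by rewrite size_poly_eq0.
case su: (size u) => [//|d] _; rewrite (falling_comb_widen (eq_leq su)) big_ord_recr /=.
have ud: u`_d != 0 by rewrite -[d]/(d.+1.-1) -su lead_coef_eq0.
rewrite -size_poly_eq0 addrC size_polyDl size_scale ?size_falling //.
rewrite ltnS; apply: leq_trans (size_sum _ _ _) _; apply/bigmax_leqP => i _.
by apply: leq_trans (size_scale_leq _ _) _; rewrite size_falling.
Qed.

Lemma stirling2_exists (n : nat) :
  exists s : {poly rat}, 'X^n == falling_comb s.
Proof.
elim: n => [|n [s /eqP IHn]].
  exists 1; rewrite /falling_comb size_poly1 big_ord1 coef1 scale1r.
  by rewrite /falling big_ord0.
exists ('X * (s + s^`())); apply/eqP.
rewrite (@falling_comb_widen (size s).+1); last first.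
  apply/leq_sizeP => -[//|j] sj; rewrite coefXM /= coefD coef_deriv.
  by rewrite !nth_default ?mul0rn ?addr0 // ltnW.
rewrite big_ord_recl coefXM /= scale0r add0r exprS IHn.
have -> : \sum_(i < size s) ('X * (s + s^`()))`_(bump 0 i) *: falling 'X (bump 0 i)
  = \sum_(i < size s) (s`_i *: falling 'X i.+1 + (s`_i.+1 *+ i.+1) *: falling 'X i.+1).
  by apply: eq_bigr => i _; rewrite coefXM /= add0n coefD coef_deriv scalerDl.
rewrite big_split /=.
have -> : \sum_(i < size s) (s`_i.+1 *+ i.+1) *: falling ('X : {poly rat}) i.+1
        = \sum_(i < size s) (s`_i *+ i) *: falling 'X i.
  transitivity (\sum_(i < (size s).+1) (s`_i *+ i) *: falling ('X : {poly rat}) i).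
    by rewrite [RHS]big_ord_recl mulr0n scale0r add0r.
  by rewrite big_ord_recr /= nth_default // mul0rn scale0r addr0.
rewrite -big_split /falling_comb mulr_sumr; apply: eq_bigr => i _ /=.
have -> : falling ('X : {poly rat}) i.+1 = falling 'X i * ('X - i%:R).
  by rewrite /falling big_ord_recr.
rewrite mulrBr scalerBr mulr_natr -scalerMnr -scalerMnl subrK.
by rewrite -scalerAr [in LHS]mulrC.
Qed.

Definition stirling2 (n k : nat) : rat := (xchoose (stirling2_exists n))`_k.

Definition nstirling2 (n k : nat) : rat :=
  k`!%:R / n`!%:R * stirling2 n k.

(* Formal power series in [x], given by their coefficients. *)

Definition fps_one (R : pzRingType) (n : nat) : R := (n == 0%N)%:R.

Definition fps_var (R : pzRingType) (n : nat) : R := (n == 1%N)%:R.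

Definition fps_mul (R : pzRingType) (a b : nat -> R) (n : nat) : R :=
  \sum_(i < n.+1) a i * b (n - i)%N.

Definition fps_pow (R : pzRingType) (a : nat -> R) (m : nat) : nat -> R :=
  iter m (fps_mul a) (@fps_one R).

(* The geometric series [\sum_j (1 - a)^j], which is [1 / a] when [a 0 = 1];
   the terms with [j > n] do not contribute to the coefficient of [x^n]. *)
Definition fps_inv (R : pzRingType) (a : nat -> R) (n : nat) : R :=
  \sum_(j < n.+1) fps_pow (fun k => fps_one R k - a k) j n.

(* [e^(tx)], where [t] is the polynomial variable ['X]. *)
Definition fps_exp_tx (n : nat) : {poly rat} := n`!%:R^-1 *: 'X^n.

Definition fps_expm1 (n : nat) : {poly rat} :=
  if n == 0%N then 0 else (n`!%:R^-1)%:P.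

Definition fps_expm1_divx (n : nat) : {poly rat} := fps_expm1 n.+1.

Definition bernoulli_poly (m n : nat) : {poly rat} :=
  n`!%:R *: fps_mul (fps_pow (fps_inv fps_expm1_divx) m) fps_exp_tx n.

Section Truncation.
Variables (R : comNzRingType) (N : nat).
Implicit Types (a b : nat -> R) (p q : {poly R}).

Let eqN p q := forall i, (i < N)%N -> p`_i = q`_i.
Let tr a : {poly R} := \poly_(i < N) a i.

Let eqN_mul p p' q q' : eqN p p' -> eqN q q' -> eqN (p * q) (p' * q').
Proof.
move=> hp hq i iN; rewrite !coefM; apply: eq_bigr => -[j /= ji] _.
by rewrite hp ?hq //; apply: leq_ltn_trans iN; rewrite ?leq_subr // -ltnS.
Qed.

Let eqN_exp p q m : eqN p q -> eqN (p ^+ m) (q ^+ m).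
Proof.
move=> pq; elim: m => [|m IHm]; first by move=> i _; rewrite !expr0.
by rewrite !exprS; apply: eqN_mul.
Qed.

Let tr_eq a p : (forall i, (i < N)%N -> a i = p`_i) -> eqN (tr a) p.
Proof. by move=> h i iN; rewrite coef_poly iN h. Qed.

Let tr_mul a b : eqN (tr (fps_mul a b)) (tr a * tr b).
Proof.
apply: tr_eq => i iN; rewrite coefM; apply: eq_bigr => -[j /= ji] _.
by rewrite !coef_poly !ifT //; apply: leq_ltn_trans iN; rewrite ?leq_subr // -ltnS.
Qed.

Let tr_pow a m : eqN (tr (fps_pow a m)) (tr a ^+ m).
Proof.
elim: m => [|m IHm]; first by apply: tr_eq => i iN; rewrite expr0 coef1.
move=> i iN; rewrite exprS [LHS]tr_mul //; exact: eqN_mul.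
Qed.

Let tr_inv a : a 0%N = 1 -> eqN (tr a * tr (fps_inv a)) 1.
Proof.
move=> a0; pose u : {poly R} := tr (fun k => fps_one R k - a k).
have u_small j i : (i < j)%N -> (u ^+ j)`_i = 0.
  have [v ->] : exists v, u = v * 'X.
    exists (\poly_(i < N.-1) u`_i.+1); apply/polyP => -[|k]; rewrite coefMX /=.
      by rewrite coef_poly /fps_one a0 subrr if_same.
    by rewrite !coef_poly; case: (N) => [|N'] //=; rewrite ltnS; case: ltnP.
  by move=> ij; rewrite exprMn coefMXn ij.
have inv_u : eqN (tr (fps_inv a)) (\sum_(j < N) u ^+ j).
  apply: tr_eq => i iN; rewrite coef_sum.
  rewrite /fps_inv (big_ord_widen _ (fun j => fps_pow (fun k => fps_one R k - a k) j i) iN).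
  rewrite big_mkcond; apply: eq_bigr => j _; case: ltnP => [_|ij].
    by rewrite -tr_pow // coef_poly iN.
  by rewrite u_small.
have a_u : eqN (tr a) (1 - u).
  by apply: tr_eq => i iN; rewrite coefB coef1 coef_poly iN opprB addrC subrK.
move=> i iN; rewrite (eqN_mul a_u inv_u) //.
by rewrite -opprB mulNr -subrX1 opprB coefB u_small ?subr0.
Qed.

Lemma fps_quotient (b c : nat -> R) m n : (n < N)%N -> b 0%N = 0 -> b 1%N = 1 ->
  fps_mul (fps_pow b m) (fps_mul (fps_pow (fps_inv (fun k => b k.+1)) m) c) n
  = fps_mul (fps_pow (@fps_var R) m) c n.
Proof.
move=> nN b0 b1; have trE d : d n = (tr d)`_n by rewrite coef_poly nN.
rewrite [LHS]trE [RHS]trE.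
have b_eq : eqN (tr b) (tr (@fps_var R) * tr (fun k => b k.+1)).
  move=> i iN; rewrite -tr_mul // !coef_poly iN /fps_mul.
  case: i iN => [|i] iN; first by rewrite big_ord1 /fps_var mul0r.
  rewrite big_ord_recl big_ord_recl big1 => [|j _]; last by rewrite /fps_var mul0r.
  by rewrite /fps_var /= mul0r mul1r add0r addr0 subSS subn0.
have inv1 : eqN (tr (fun k => b k.+1) * tr (fps_inv (fun k => b k.+1))) 1 by exact: tr_inv.
rewrite tr_mul // (eqN_mul (tr_pow b m) (tr_mul _ _)) //.
rewrite (eqN_mul (eqN_exp m b_eq) (eqN_mul (tr_pow _ m) (fun i _ => erefl _))) //.
rewrite exprMn mulrA -[X in X * _]mulrA -exprMn.
rewrite [RHS]tr_mul // [RHS](eqN_mul (tr_pow _ m) (fun i _ => erefl _)) //.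
apply: eqN_mul nN => // i iN.
rewrite -[RHS]/((_)`_i) -[in RHS](mulr1 (_ ^+ m)) -[in RHS](expr1n _ m).
exact: (eqN_mul (fun i _ => erefl _) (eqN_exp m inv1)).
Qed.

End Truncation.

(* [(e^x - 1)^m \sum_n B_n^(m)(t) x^n / n! = x^m e^(tx)] *)
Lemma bernoulli_polyP (m : nat) :
  fps_mul (fps_pow fps_expm1 m) (fun n => n`!%:R^-1 *: bernoulli_poly m n)
  =1 fps_mul (fps_pow (@fps_var {poly rat}) m) fps_exp_tx.
Proof.
move=> n; rewrite -(@fps_quotient _ n.+1 fps_expm1) //.
apply: eq_bigr => i _; congr (_ * _).
by rewrite /bernoulli_poly scalerA mulVf ?scale1r // pnatr_eq0 -lt0n fact_gt0.
Qed.

(* [x^n = \sum_k S(n, k) (x)_k], and this determines the [S(n, k)]. *)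
Lemma stirling2P (n : nat) (s : {poly rat}) :
  'X^n = falling_comb s <-> forall k, s`_k = stirling2 n k.
Proof.
have /eqP h := xchooseP (stirling2_exists n); split=> [|hs].
  by rewrite h => /falling_comb_inj <-.
by rewrite h; congr falling_comb; apply/polyP => k; rewrite hs.
Qed.

(* Main.v *)
Require Import Defs.
From mathcomp Require Import all_boot all_order all_algebra.
From mathcomp Require Import finfield ring.

Set Implicit Arguments.
Unset Strict Implicit.
Unset Printing Implicit Defensive.

Import Order.TTheory GRing.Theory Num.Theory.
Local Open Scope ring_scope.

(* Put D = (e^x - 1)/x and let s be the residue of -n modulo p - 1. The three
   sums for m >= 0 are expressions of the coefficient of x^s in D^m e^(-rx), and
   B_s^(-m)(-r)/s! is the same coefficient for m <= 0, so it suffices to show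
     F_p(n, r) = (-1)^n [x^s] D^n e^(-rx)   (mod p).
   Modulo (p, x^(p-1)) one has D^p = 1, so only n mod p matters on the right.
   For 1 <= n <= p - 1 the congruence is Fermat's [k = r] = 1 - (k - r)^(p-1).
   Then (-1)^k binom(p-1, k) = 1 - p v_k for 0 <= k < p, whence
     F_p(n + p - 1, r) = \sum_(k < p) v_k F_p(n, r - k)   for n >= 1,
   and the right-hand side satisfies the same recurrence modulo p: v_k is the
   k-th harmonic number modulo p, which makes D times \sum_(k < p) v_k e^(kx)
   equal to 1 modulo (p, x^(p-1)). *)

(** * Signed binomial sums as iterated differences *)

Definition altsum (R : comPzRingType) (M : nat) (g : nat -> R) : R :=
  \sum_(k < M.+1) 'C(M, k)%:R * (-1) ^+ k * g k.

(** Pascal's rule: [altsum M] is the operator (1 - shift)^M evaluated at 0, and one factor is split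
    off. *)
Lemma altsumS (R : comPzRingType) (M : nat) (g : nat -> R) :
  altsum M.+1 g = altsum M g - altsum M (fun k => g k.+1).
Proof.
have -> : altsum M g = \sum_(k < M.+2) 'C(M, k)%:R * (-1) ^+ k * g k.
  by rewrite [RHS]big_ord_recr /= bin_small // !mul0r addr0.
rewrite /altsum [LHS]big_ord_recl [in RHS]big_ord_recl !bin0 -addrA; congr (_ + _).
rewrite -sumrB; apply: eq_bigr => i _.
by rewrite /= binS natrD exprS; ring.
Qed.

Lemma sum_signed_binom (R : comPzRingType) (M : nat) (g : nat -> R) :
  \sum_(k < M.+1) 'C(M, k)%:R * (-1) ^+ (M - k) * g k = (-1) ^+ M * altsum M g.
Proof.
rewrite mulr_sumr; apply: eq_bigr => -[k /= kM] _.
have -> : (-1 : R) ^+ M = (-1) ^+ (M - k) * (-1) ^+ k by rewrite -exprD subnK.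
have := sqrr_sign R k; move: ((-1) ^+ (M - k)) ((-1) ^+ k) => a b b2.
by rewrite -[LHS]mulr1 -b2; ring.
Qed.

(** * Truncated power series *)

(** Congruence modulo X^N. Polynomials up to this relation stand for coefficient sequences, so that
    ring identities become available. *)
Definition eqX (R : nzRingType) (N : nat) (a b : {poly R}) : Prop :=
  forall i, (i < N)%N -> a`_i = b`_i.

Section Truncation.
Variable R : comNzRingType.
Implicit Types (N : nat) (a b c : {poly R}) (u v : nat -> R).

Lemma eqX_refl N a : eqX N a a. Proof. by []. Qed.

Lemma eqX_sym N a b : eqX N a b -> eqX N b a.
Proof. by move=> ab i iN; rewrite ab. Qed.

Lemma eqX_trans N a b c : eqX N a b -> eqX N b c -> eqX N a c.
Proof. by move=> ab bc i iN; rewrite ab ?bc. Qed.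

Lemma eqXM N a a' b b' : eqX N a a' -> eqX N b b' -> eqX N (a * b) (a' * b').
Proof.
move=> aa' bb' i iN; rewrite !coefM; apply: eq_bigr => -[j /= ji] _.
by rewrite aa' ?bb' //; apply: leq_ltn_trans iN; rewrite ?leq_subr // -ltnS.
Qed.

Lemma eqXE N a a' M : eqX N a a' -> eqX N (a ^+ M) (a' ^+ M).
Proof. by move=> aa'; elim: M => [|M IHM]; rewrite ?expr0 // !exprS; apply: eqXM. Qed.

Lemma fps_mul_coef N a b u v i :
    (forall j, (j < N)%N -> a`_j = u j) -> (forall j, (j < N)%N -> b`_j = v j) ->
  (i < N)%N -> fps_mul u v i = (a * b)`_i.
Proof.
move=> au bv iN; rewrite coefM; apply: eq_bigr => -[j /= ji] _.
by rewrite au ?bv //; apply: leq_ltn_trans iN; rewrite ?leq_subr // -ltnS.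
Qed.

Lemma fps_pow_coef N a u M i :
    (forall j, (j < N)%N -> a`_j = u j) ->
  (i < N)%N -> fps_pow u M i = (a ^+ M)`_i.
Proof.
move=> au; elim: M i => [|M IHM] i iN; first by rewrite expr0 coef1.
rewrite exprS; apply: (fps_mul_coef au) iN => j jN; exact/esym/IHM.
Qed.

(** [b] is a multiple of X, hence [b ^+ j] is a multiple of X^j. *)
Lemma coef_exp_small b i j : b`_0 = 0 -> (i < j)%N -> (b ^+ j)`_i = 0.
Proof.
move=> b0; elim: j i => // j IHj i ij; rewrite exprS coefM big1 // => -[[|k] /= ki] _.
  by rewrite b0 mul0r.
by rewrite IHj ?mulr0 //; apply: leq_ltn_trans (leq_sub2l i (ltn0Sn k)) _; rewrite ltn_subLR // (leq_trans (ltn0Sn k)).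
Qed.

(** The range j <= i of the geometric series, which varies with the coefficient, becomes a fixed
    one; the extra terms vanish because 1 - [a] has no constant term. *)
Lemma fps_inv_coef N a u i :
    (forall j, (j < N)%N -> a`_j = u j) -> a`_0 = 1 ->
  (i < N)%N -> fps_inv u i = (\sum_(j < N) (1 - a) ^+ j)`_i.
Proof.
move=> au a0 iN; rewrite coef_sum /fps_inv.
have -> : \sum_(j < N) ((1 - a) ^+ j)`_i = \sum_(j < i.+1) ((1 - a) ^+ j)`_i.
  rewrite (big_ord_widen _ (fun j => ((1 - a) ^+ j)`_i) iN) [RHS]big_mkcond.
  apply: eq_bigr => j _; case: ltnP => // ij.
  by rewrite coef_exp_small // coefB coef1 a0 subrr.
apply: eq_bigr => j _; apply: (@fps_pow_coef N) => // k kN.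
by rewrite coefB coef1 au.
Qed.

End Truncation.

(** * Coefficients of ((e^x - 1)/x)^M e^(tx) *)

Section ExponentialSeries.
Variable K : fieldType.
Implicit Types (t s : K) (N M i j : nat).

(* In characteristic p, [exp_coef t i = 0] for [i >= p], as [i`! = 0] and
   [0^-1 = 0]; likewise for [expm1_divx_coef i] when [i >= p - 1]. *)
Definition exp_coef t i : K := t ^+ i / i`!%:R.

Definition expm1_divx_coef i : K := i.+1`!%:R^-1.

Definition expm1_pow_exp M t j : K :=
  fps_mul (fps_pow expm1_divx_coef M) (exp_coef t) j.

Definition exp_poly N t : {poly K} := \poly_(i < N) exp_coef t i.

Definition expm1_divx_poly N : {poly K} := \poly_(i < N) expm1_divx_coef i.

Lemma expm1_pow_exp_coef N M t j : (j < N)%N ->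
  expm1_pow_exp M t j = (expm1_divx_poly N ^+ M * exp_poly N t)`_j.
Proof.
apply: fps_mul_coef => i iN; last by rewrite coef_poly iN.
by apply: esym; apply: fps_pow_coef iN => k kN; rewrite coef_poly kN.
Qed.

Lemma expm1_divx_polyP N :
  eqX N ('X * expm1_divx_poly N) (exp_poly N 1 - 1).
Proof.
move=> i iN; rewrite coefXM coefB coef1 !coef_poly iN /exp_coef expr1n mul1r.
by case: i iN => [|i] iN; rewrite ?subrr ?subr0 ?invr1 ?subrr //= (ltnW iN).
Qed.

Lemma fact_neq0_leq N i : (i <= N)%N -> N`!%:R != 0 :> K -> i`!%:R != 0 :> K.
Proof.
move=> iN; apply: contra_neq => i0.
by rewrite -(bin_fact iN) !natrM i0 mul0r mulr0.
Qed.

(** Binomial theorem. Only factorials up to (N - 1)! are inverted, so N = p is admissible in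
    characteristic p. *)
Lemma exp_polyM N s t : N.-1`!%:R != 0 :> K ->
  eqX N (exp_poly N s * exp_poly N t) (exp_poly N (s + t)).
Proof.
move=> N0 i iN; have fact0 j : (j <= i)%N -> j`!%:R != 0 :> K.
  by move=> ji; apply: fact_neq0_leq N0; apply: leq_trans ji _; case: N iN.
rewrite -(@fps_mul_coef _ N _ _ (exp_coef s) (exp_coef t)) //; first last.
- by move=> j jN; rewrite coef_poly jN.
- by move=> j jN; rewrite coef_poly jN.
rewrite coef_poly iN /exp_coef addrC exprDn mulr_suml; apply: eq_bigr => -[j /= ji] _.
have ji' : (j <= i)%N by [].
rewrite -(bin_fact ji') !natrM -mulr_natr.
field.
(* The binomial coefficient must be nonzero too; it is a factor of i!. *)
by rewrite !fact0 ?leq_subr // -[_ != 0]andbT; move: (fact0 i (leqnn i)); rewrite -(bin_fact ji') !natrM !mulf_eq0 !negb_or => /andP[-> _].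
Qed.

(** Compare coefficients of x^(j+1) in (e^x - 1) D^M e^(tx) = D^M e^((t+1)x) - D^M e^(tx), where D =
    (e^x - 1)/x. *)
Lemma expm1_pow_expS M t j : j.+1`!%:R != 0 :> K ->
  expm1_pow_exp M.+1 t j = expm1_pow_exp M (t + 1) j.+1 - expm1_pow_exp M t j.+1.
Proof.
move=> j0; rewrite (@expm1_pow_exp_coef j.+2 M.+1) // !(@expm1_pow_exp_coef j.+2 M) //.
set D := expm1_divx_poly _; set E := exp_poly _.
transitivity ('X * D * (D ^+ M * E t))`_j.+1.
  by rewrite exprS -!mulrA coefXM.
rewrite (eqXM (@expm1_divx_polyP _) (@eqX_refl _ _ _)) // mulrBl mul1r coefB.
congr (_ - _); rewrite mulrCA.
by rewrite (eqXM (@eqX_refl _ _ _) (@exp_polyM j.+2 _ _ j0)) // addrC.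
Qed.

(** Amounts to expanding (e^x - 1)^M e^(tx) and dividing by x^M. In characteristic p the hypothesis
    still allows M + j = p - 1, the case that the Fleck sums need. *)
Lemma expm1_pow_expE M t j : (M + j)`!%:R != 0 :> K ->
  expm1_pow_exp M t j
  = \sum_(k < M.+1) 'C(M, k)%:R * (-1) ^+ (M - k)
      * ((k%:R + t) ^+ (M + j) / (M + j)`!%:R).
Proof.
rewrite (sum_signed_binom M (fun k => (k%:R + t) ^+ (M + j) / (M + j)`!%:R)).
elim: M t j => [|M IHM] t j Mj0.
  rewrite expr0 mul1r /altsum big_ord1 !mul1r add0r /expm1_pow_exp /fps_mul.
  by rewrite big_ord_recl big1 ?mul1r ?subn0 ?addr0 // => i _; rewrite mul0r.
have Mj : (M.+1 + j = M + j.+1)%N by rewrite addSnnS.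
rewrite expm1_pow_expS; last by apply: fact_neq0_leq Mj0; rewrite Mj leq_addl.
rewrite Mj !IHM -?Mj // altsumS exprS.
have -> : altsum M (fun k => (k%:R + (t + 1)) ^+ (M.+1 + j) / (M.+1 + j)`!%:R)
          = altsum M (fun k => (k.+1%:R + t) ^+ (M.+1 + j) / (M.+1 + j)`!%:R).
  by apply: eq_bigr => k _; rewrite -natr1 -addrA (addrC 1).
ring.
Qed.

End ExponentialSeries.

(** * Stirling numbers *)

Lemma fallingS (R : pzRingType) (x : R) i : falling x i.+1 = falling x i * (x - i%:R).
Proof. by rewrite /falling big_ord_recr. Qed.

Lemma falling_shift (R : comPzRingType) (x : R) i :
  falling (x + 1) i.+1 = (x + 1) * falling x i.
Proof.
rewrite /falling big_ord_recl subr0; congr (_ * _).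
by apply: eq_bigr => j _; rewrite -natr1 opprD addrACA addrC [in LHS]addrACA; ring.
Qed.

(** Discrete analogue of the derivative of x^i. At i = 0 the factor [i%:R] makes the truncated
    [i.-1] harmless. *)
Lemma difference_falling (R : comPzRingType) (x : R) i :
  falling (x + 1) i - falling x i = i%:R * falling x i.-1.
Proof.
case: i => [|i]; first by rewrite /falling !big_ord0 subrr mul0r.
by rewrite falling_shift fallingS -natr1; ring.
Qed.

Lemma sum_signed_binom_falling (R : comPzRingType) (x : R) M j :
  \sum_(k < M.+1) 'C(M, k)%:R * (-1) ^+ (M - k) * falling (k%:R + x) j
  = (j ^_ M)%:R * falling x (j - M).
Proof.
rewrite (sum_signed_binom M (fun k => falling (k%:R + x) j)).
elim: M x => [|M IHM] x.
  by rewrite expr0 mul1r /altsum big_ord1 !mul1r add0r subn0.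
rewrite altsumS exprS.
have -> : altsum M (fun k => falling (k.+1%:R + x) j)
          = altsum M (fun k => falling (k%:R + (x + 1)) j).
  by apply: eq_bigr => k _; rewrite -natr1 -addrA (addrC 1).
rewrite -mulrA mulrBr mulrBr IHM IHM mulN1r mulN1r opprK addrC -mulrBr.
by rewrite difference_falling ffactnSr natrM subnS mulrA.
Qed.

Lemma horner_falling (x : rat) k : (falling 'X k).[x] = falling x k.
Proof.
by rewrite horner_prod; apply: eq_bigr => i _; rewrite !hornerE -polyC_natr hornerC.
Qed.

(** The falling factorial of index k has degree k, so the top term cannot cancel. This bounds the
    support of [stirling2 n] by n. *)
Lemma size_falling_comb (s : {poly rat}) : size (falling_comb s) = size s.
Proof.
have [->|s0] := eqVneq s 0; first by rewrite /falling_comb size_poly0 big_ord0 size_poly0.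
case sd: (size s) => [|d]; first by rewrite -size_poly_eq0 sd in s0.
have ud: s`_d != 0 by rewrite -[d]/(d.+1.-1) -sd lead_coef_eq0.
rewrite (falling_comb_widen (eq_leq sd)) big_ord_recr /=.
rewrite addrC size_polyDl size_scale ?size_falling // ltnS.
apply: leq_trans (size_sum _ _ _) _; apply/bigmax_leqP => i _.
by apply: leq_trans (size_scale_leq _ _) _; rewrite size_falling.
Qed.

Lemma exp_stirling2 (x : rat) n :
  x ^+ n = \sum_(j < n.+1) stirling2 n j * falling x j.
Proof.
have /eqP Xn := xchooseP (stirling2_exists n).
have sn : (size (xchoose (stirling2_exists n)) <= n.+1)%N.
  by rewrite -size_falling_comb -Xn size_polyXn.
rewrite -hornerXn Xn (falling_comb_widen sn) horner_sum.
by apply: eq_bigr => j _; rewrite hornerZ horner_falling.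
Qed.

Lemma sum_signed_binom_exp (x : rat) M n :
  \sum_(k < M.+1) 'C(M, k)%:R * (-1) ^+ (M - k) * (k%:R + x) ^+ n
  = \sum_(j < n.+1) stirling2 n j * ((j ^_ M)%:R * falling x (j - M)).
Proof.
under eq_bigr do rewrite exp_stirling2 mulr_sumr.
rewrite exchange_big; apply: eq_bigr => j _.
rewrite -sum_signed_binom_falling mulr_sumr; apply: eq_bigr => k _; ring.
Qed.

Lemma natr_fact_neq0 i : i`!%:R != 0 :> rat.
Proof. by rewrite pnatr_eq0 -lt0n fact_gt0. Qed.

(** Powers are expanded in falling factorials; the M-th difference kills those of degree below M and
    lowers the degree of the others by M. *)
Lemma expm1_pow_exp_stirling2_binom (x : rat) M j :
  expm1_pow_exp M x j = \sum_(k < j.+1) nstirling2 (M + j) (M + k) * binom x k.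
Proof.
rewrite expm1_pow_expE ?natr_fact_neq0 //.
under eq_bigr do rewrite mulrA.
rewrite -mulr_suml sum_signed_binom_exp -addnS big_split_ord /=.
rewrite big1 ?add0r => [|i _]; last by rewrite ffact_small // mul0r mulr0.
rewrite mulr_suml; apply: eq_bigr => k _; rewrite addKn /nstirling2 /binom.
rewrite -(ffact_fact (leq_addr k M)) addKn natrM.
have := natr_fact_neq0 k; have := natr_fact_neq0 (M + j); move: (_`!%:R) (k`!%:R).
by move=> a b a0 b0; field; rewrite a0 b0.
Qed.

(** The preceding expansion at argument 0, where only the term k = 0 survives. *)
Lemma expm1_pow_coef_stirling2 M i :
  fps_pow (@expm1_divx_coef rat) M i = nstirling2 (i + M) M.
Proof.
have -> : fps_pow (@expm1_divx_coef rat) M i = expm1_pow_exp M 0 i.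
  rewrite /expm1_pow_exp /fps_mul big_ord_recr /= subnn /exp_coef invr1 !mulr1.
  rewrite big1 ?add0r // => k _.
  by rewrite expr0n subn_eq0 leqNgt ltn_ord mul0r mulr0.
rewrite expm1_pow_exp_stirling2_binom big_ord_recl big1 => [|k _].
  by rewrite addr0 addn0 addnC /binom /falling big_ord0 divr1.
by rewrite /binom /falling big_ord_recl subrr mul0r mul0r mulr0.
Qed.

Lemma expm1_pow_exp_stirling2_exp (x : rat) M j :
  expm1_pow_exp M x j
  = \sum_(k < j.+1) nstirling2 (j - k + M) M * (x ^+ k / k`!%:R).
Proof.
rewrite /expm1_pow_exp /fps_mul (reindex_inj rev_ord_inj) /=.
apply: eq_bigr => k _; rewrite subSS expm1_pow_coef_stirling2 subKn //.
by rewrite -ltnS.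
Qed.

(** * Reduction modulo p *)

(** [x] is p-integral with residue [y]. Any fraction with denominator prime to p may serve as
    witness, so ring operations need no reduced fractions. *)
Definition reduces (p : nat) (x : rat) (y : 'F_p) : Prop :=
  exists a d : int,
    [/\ d%:~R != 0 :> 'F_p, x = a%:~R / d%:~R & y = a%:~R / d%:~R].

Section Reduction.
Variable p : nat.
Hypothesis p_prime : prime p.
Local Notation Fp := 'F_p.
Implicit Types (x : rat) (y : Fp).

Lemma intr_Fp_neq0 (d : int) : d%:~R != 0 :> Fp -> d%:~R != 0 :> rat.
Proof. by apply: contra_neq => /eqP; rewrite intr_eq0 => /eqP ->. Qed.

Lemma reduces_int (a : int) : reduces a%:~R (a%:~R : Fp).
Proof. by exists a, 1; split; rewrite ?divr1 ?oner_neq0. Qed.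

Lemma reduces_nat (a : nat) : reduces a%:R (a%:R : Fp).
Proof. exact: (reduces_int a). Qed.

Lemma reducesD x x' y y' : reduces x y -> reduces x' y' -> reduces (x + x') (y + y').
Proof.
move=> [a [d [d0 -> ->]]] [b [e [e0 -> ->]]]; exists (a * e + b * d), (d * e).
by rewrite !rmorphD !rmorphM /= mulf_neq0 ?addf_div ?intr_Fp_neq0.
Qed.

Lemma reducesM x x' y y' : reduces x y -> reduces x' y' -> reduces (x * x') (y * y').
Proof.
move=> [a [d [d0 -> ->]]] [b [e [e0 -> ->]]]; exists (a * b), (d * e).
by rewrite !rmorphM /= mulf_neq0 ?mulf_div.
Qed.

Lemma reducesN x y : reduces x y -> reduces (- x) (- y).
Proof.
by move=> [a [d [d0 -> ->]]]; exists (- a), d; rewrite !rmorphN !mulNr.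
Qed.

Lemma reducesB x x' y y' : reduces x y -> reduces x' y' -> reduces (x - x') (y - y').
Proof. by move=> xy xy'; apply/reducesD/reducesN. Qed.

Lemma reducesX x y i : reduces x y -> reduces (x ^+ i) (y ^+ i).
Proof.
move=> xy; elim: i => [|i IHi]; first exact: (reduces_nat 1).
by rewrite !exprS; apply: reducesM.
Qed.

Lemma fact_Fp_neq0 i : (i < p)%N -> i`!%:R != 0 :> Fp.
Proof.
rewrite -(dvdn_pcharf (pchar_Fp p_prime)).
elim: i => [|i IHi] ip; first by rewrite dvdn1 neq_ltn prime_gt1 ?orbT.
by rewrite factS Euclid_dvdM // negb_or IHi ?andbT ?(ltnW ip) // gtnNdvd.
Qed.

Lemma reduces_factV i : (i < p)%N -> reduces (i`!%:R^-1) (i`!%:R^-1 : Fp).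
Proof. by move=> ip; exists 1, i`!; rewrite !mul1r; split; rewrite // fact_Fp_neq0. Qed.

(** The difference is a/d with d prime to p and a zero in F_p; so a = p b, and b/d is the required
    p-integral quotient. *)
Lemma congr_mod_reduces x x' y : reduces x y -> reduces x' y -> congr_mod p x x'.
Proof.
move=> xy xy'; have [a [d [d0 xx' /esym/eqP]]] := reducesB xy xy'.
rewrite subrr mulf_eq0 invr_eq0 (negPf d0) orbF.
rewrite -(dvdz_pcharf (pchar_Fp p_prime)) => /dvdzP[b ab].
exists (b%:~R / d%:~R); last by rewrite xx' ab rmorphM /= mulrAC mulrC.
apply: contra (d0); rewrite -(dvdz_pcharf (pchar_Fp p_prime)) => pden.
set q := b%:~R / d%:~R in pden; apply: dvdz_trans pden _.
(* The reduced denominator of b/d divides d, being coprime to the reduced numerator. *)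
have -> : (denq q %| d)%Z = (denq q %| numq q * d)%Z.
  by rewrite Gauss_dvdzr // coprimez_sym; apply: coprime_num_den.
apply/dvdzP; exists b; apply/eqP; rewrite -(eqr_int rat) !rmorphM /=.
by rewrite -eqr_div ?intr_eq0 ?denq_neq0 -?(intr_eq0 rat) ?intr_Fp_neq0 // divq_num_den.
Qed.

End Reduction.

(** * Transfer of series operations along a relation between coefficients *)

Section FpsRelation.
Variables (R S : pzRingType) (P : R -> S -> Prop).
Hypothesis P0 : P 0 0.
Hypothesis P1 : P 1 1.
Hypothesis PD : forall x x' y y', P x y -> P x' y' -> P (x + x') (y + y').
Hypothesis PN : forall x y, P x y -> P (- x) (- y).
Hypothesis PM : forall x x' y y', P x y -> P x' y' -> P (x * x') (y * y').

(** [P] stays abstract because it is used for [reduces] and for [reduces] after evaluation of a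
    polynomial. The bound N matters since factorials are invertible modulo p only below p!. *)
Definition fps_rel N (u : nat -> R) (u' : nat -> S) :=
  forall i, (i < N)%N -> P (u i) (u' i).

Lemma rel_sum n (f : nat -> R) (g : nat -> S) :
  fps_rel n f g -> P (\sum_(i < n) f i) (\sum_(i < n) g i).
Proof.
elim: n => [|n IHn] fg; first by rewrite !big_ord0.
rewrite !big_ord_recr; apply: PD; last exact: fg.
by apply: IHn => i ni; apply/fg/ltnW.
Qed.

Lemma fps_rel_mul N u u' v v' :
  fps_rel N u u' -> fps_rel N v v' -> fps_rel N (fps_mul u v) (fps_mul u' v').
Proof.
move=> uu' vv' i iN; apply: (@rel_sum i.+1 (fun j => u j * v (i - j)%N)
  (fun j => u' j * v' (i - j)%N)) => j; rewrite ltnS => ji.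
by apply: PM; [apply: uu' | apply: vv']; apply: leq_ltn_trans iN; rewrite ?leq_subr.
Qed.

Lemma fps_rel_pow N u u' M :
  fps_rel N u u' -> fps_rel N (fps_pow u M) (fps_pow u' M).
Proof.
move=> uu'; elim: M => [|M IHM]; last exact: fps_rel_mul.
by move=> [|i] _.
Qed.

Lemma fps_rel_inv N u u' :
  fps_rel N u u' -> fps_rel N (fps_inv u) (fps_inv u').
Proof.
move=> uu' i iN; apply: (@rel_sum i.+1 (fun j => fps_pow _ j i) (fun j => fps_pow _ j i)).
move=> j _; apply: fps_rel_pow iN => k kN; apply: PD; last exact/PN/uu'.
by case: k kN.
Qed.

End FpsRelation.

Section TransferModP.
Variable p : nat.
Hypothesis p_prime : prime p.
Local Notation Fp := 'F_p.

Lemma reduces_exp_coef (x : rat) (y : Fp) i :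
  reduces x y -> (i < p)%N -> reduces (exp_coef x i) (exp_coef y i).
Proof. by move=> xy ip; apply: reducesM; [apply: reducesX | apply: reduces_factV]. Qed.

(** The bound is p - 1 rather than p because the coefficient of x^j in (e^x - 1)/x is 1/(j+1)!. *)
Lemma reduces_expm1_pow_exp M (x : rat) (y : Fp) j :
  reduces x y -> (j < p.-1)%N -> reduces (expm1_pow_exp M x j) (expm1_pow_exp M y j).
Proof.
move=> xy; have p0 := prime_gt0 p_prime; pose P := @reduces p.
apply: (fps_rel_mul (P := P)) j => [|||j|j].
- exact: (reduces_nat _ 0).
- exact: reducesD.
- exact: reducesM.
- apply: (fps_rel_pow (P := P)) j => [||||j jp].
  + exact: (reduces_nat _ 0).
  + exact: (reduces_nat _ 1).
  + exact: reducesD.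
  + exact: reducesM.
  by apply: reduces_factV; rewrite // -(prednK p0) ltnS.
by move=> jp; apply: reduces_exp_coef => //; apply: leq_trans jp (leq_pred p).
Qed.

Lemma reduces_bernoulli_poly M (x : rat) (y : Fp) j :
    reduces x y -> (j < p.-1)%N ->
  reduces (bernoulli_poly M j).[x]
    (j`!%:R * fps_mul (fps_pow (fps_inv (@expm1_divx_coef Fp)) M) (exp_coef y) j).
Proof.
move=> xy jp; have p0 := prime_gt0 p_prime.
(* Evaluation at [x] followed by reduction respects the ring operations, so it passes through the
   series with polynomial coefficients. *)
pose P (q : {poly rat}) (z : Fp) := reduces q.[x] z.
have P0 : P 0 0 by rewrite /P horner0; apply: (reduces_nat _ 0).
have P1 : P 1 1 by rewrite /P hornerE; apply: (reduces_nat _ 1).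
have PD q q' z z' : P q z -> P q' z' -> P (q + q') (z + z').
  by rewrite /P hornerD; apply: reducesD.
have PM q q' z z' : P q z -> P q' z' -> P (q * q') (z * z').
  by rewrite /P hornerM; apply: reducesM.
have PN q z : P q z -> P (- q) (- z) by rewrite /P hornerN; apply: reducesN.
rewrite hornerZ; apply: reducesM; first exact: reduces_nat.
apply: (fps_rel_mul P0 PD PM) jp => i ip.
  apply: (fps_rel_pow P0 P1 PD PM) ip => k kp.
  apply: (fps_rel_inv P0 P1 PD PN PM) kp => l lp.
  by rewrite /P hornerC; apply: reduces_factV; rewrite // -(prednK p0) ltnS.
rewrite /P hornerZ hornerXn mulrC; apply: reduces_exp_coef => //.
exact: leq_trans ip (leq_pred p).
Qed.

End TransferModP.

(** * The exponential series modulo p *)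

Lemma summation_by_parts (R : comPzRingType) (v g : nat -> R) n :
  \sum_(k < n.+1) v k * (g k.+1 - g k)
  = v n * g n.+1 - v 0%N * g 0%N - \sum_(k < n) (v k.+1 - v k) * g k.+1.
Proof.
elim: n => [|n IHn]; first by rewrite big_ord1 big_ord0; ring.
by rewrite big_ord_recr IHn big_ord_recr /=; ring.
Qed.

Section SeriesModP.
Variable p : nat.
Hypothesis p_prime : prime p.
Local Notation Fp := 'F_p.
Local Notation D := (expm1_divx_poly Fp p).
Local Notation E := (@exp_poly Fp p).
Implicit Types (t : Fp) (i j k n M : nat).

Let p_gt0 : (0 < p)%N := prime_gt0 p_prime.
Let natp0 : p%:R = 0 :> Fp := pchar_Fp_0 p_prime.

Lemma fact_predp_neq0 : p.-1`!%:R != 0 :> Fp.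
Proof. by apply: fact_Fp_neq0; rewrite ?prednK. Qed.

(** Frobenius: D^p = 1 + (D - 1)^p, and D - 1 is a multiple of X. *)
Lemma expm1_divx_expp : eqX p (D ^+ p) 1.
Proof.
move=> i ip; have pcharX : p \in [pchar {poly Fp}].
  by rewrite inE p_prime -polyC_natr natp0 eqxx.
have -> : D = 1 + (D - 1) by rewrite addrC subrK.
rewrite exprDn_pchar ?(eq_pnat _ (pcharf_eq pcharX)) ?pnat_id // expr1n coefD coef_exp_small ?addr0 //.
by rewrite coefB coef1 coef_poly p_gt0 /expm1_divx_coef invr1 subrr.
Qed.

Lemma expm1_divx_exp_muln k : eqX p (D ^+ (p * k)) 1.
Proof. by rewrite exprM -(expr1n _ k); apply/eqXE/expm1_divx_expp. Qed.

Lemma expm1_divx_exp_mod M n : M = n %[mod p] -> eqX p (D ^+ M) (D ^+ n).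
Proof.
have red a : eqX p (D ^+ a) (D ^+ (a %% p)).
  rewrite {1}(divn_eq a p) exprD mulnC -[X in eqX _ _ X]mul1r.
  by apply: eqXM => //; apply: expm1_divx_exp_muln.
by move=> Mn; apply: eqX_trans (red M) _; rewrite Mn; apply/eqX_sym/red.
Qed.

Lemma expm1_pow_exp_mod M n t j : M = n %[mod p] -> (j < p)%N ->
  expm1_pow_exp M t j = expm1_pow_exp n t j.
Proof.
move=> Mn jp; rewrite !(expm1_pow_exp_coef _ _ jp).
by rewrite (eqXM (expm1_divx_exp_mod Mn) (@eqX_refl _ _ _)).
Qed.

(** After multiplication by x, the factor e^x - 1 turns each e^(kx) into e^((k+1)x) - e^(kx). *)
Lemma mul_expm1_divx_sum_coef (v : nat -> Fp) i : (i < p.-1)%N ->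
  (D * \sum_(k < p) v k *: E k%:R)`_i
  = \sum_(k < p) v k * (exp_coef k.+1%:R i.+1 - exp_coef k%:R i.+1).
Proof.
move=> ip; have ip' : (i.+1 < p)%N by rewrite -(prednK p_gt0) ltnS.
transitivity ('X * (D * \sum_(k < p) v k *: E k%:R))`_i.+1; first by rewrite coefXM.
rewrite mulrA (eqXM (@expm1_divx_polyP _ p) (@eqX_refl _ _ _)) //.
rewrite mulr_sumr coef_sum; apply: eq_bigr => k _.
rewrite -scalerAr coefZ mulrBl mul1r coefB (exp_polyM _ _ fact_predp_neq0) //.
by rewrite !coef_poly ip' -[k.+1%:R]natr1 (addrC 1).
Qed.

(* [(e^x - 1) \sum_(k < p) e^(kx)] telescopes to [e^(px) - 1 = 0], and
   [(e^x - 1)/x] is invertible. *)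
Lemma sum_exp_Fp i : (i < p.-1)%N -> \sum_(k < p) k%:R ^+ i = 0 :> Fp.
Proof.
move=> ip; have ip' : (i < p)%N by apply: leq_trans ip (leq_pred p).
have D0 : eqX p.-1 (D * \sum_(k < p) E k%:R) 0.
  move=> j jp; have := mul_expm1_divx_sum_coef (fun=> 1) jp.
  under eq_bigr do rewrite scale1r; move=> ->; rewrite coef0.
  under eq_bigr do rewrite mul1r.
  rewrite -(big_mkord xpredT (fun k => exp_coef k.+1%:R j.+1 - exp_coef k%:R j.+1)).
  rewrite (telescope_sumr (fun k => exp_coef (k%:R : Fp) j.+1)) //.
  by rewrite natp0 subrr.
have : (\sum_(k < p) E k%:R)`_i = 0.
  (* [D ^+ p.-1] inverts [D], as D^p = 1 modulo X^p. *)
  transitivity (D ^+ p.-1 * (D * \sum_(k < p) E k%:R))`_i; last first.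
    by rewrite (eqXM (@eqX_refl _ _ _) D0) // mulr0 coef0.
  rewrite mulrA -exprSr prednK // (eqXM expm1_divx_expp (@eqX_refl _ _ _)) ?mul1r //.
rewrite coef_sum; under eq_bigr do rewrite coef_poly ip'.
rewrite -mulr_suml => /eqP; rewrite mulf_eq0 invr_eq0.
by rewrite (negPf (fact_Fp_neq0 p_prime ip')) orbF => /eqP.
Qed.

(** The hypotheses make v_k the k-th harmonic number. Summation by parts replaces v_k by its
    increments 1/(k+1), which leaves a power sum over the nonzero residues. *)
Lemma mul_expm1_divx_harmonic (v : nat -> Fp) : v 0%N = 0 ->
    (forall k, (k.+1 < p)%N -> k.+1%:R * (v k.+1 - v k) = 1) ->
  eqX p.-1 (D * \sum_(k < p) v k *: E k%:R) 1.
Proof.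
move=> v0 vS i ip; rewrite mul_expm1_divx_sum_coef // coef1.
have -> : \sum_(k < p) v k * (exp_coef k.+1%:R i.+1 - exp_coef k%:R i.+1)
  = \sum_(k < p.-1.+1) v k * (exp_coef k.+1%:R i.+1 - exp_coef k%:R i.+1).
  by rewrite prednK.
rewrite (summation_by_parts v (fun k => exp_coef (k%:R : Fp) i.+1)) v0 mul0r subr0.
(* The upper boundary term contains p^(i+1) = 0. *)
rewrite prednK // natp0 {1}/exp_coef expr0n mul0r mulr0 sub0r.
have -> : \sum_(k < p.-1) (v k.+1 - v k) * exp_coef (k.+1%:R : Fp) i.+1
          = (\sum_(k < p.-1) k.+1%:R ^+ i) / i.+1`!%:R.
  rewrite mulr_suml; apply: eq_bigr => k _; rewrite /exp_coef exprS !mulrA.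
  rewrite -(mulrC k.+1%:R) vS ?mul1r //.
  by have := ltn_ord k; rewrite -ltnS prednK.
have : \sum_(k < p.-1.+1) k%:R ^+ i = 0 :> Fp by rewrite prednK ?sum_exp_Fp.
(* The term k = 0 is 0^i, equal to 1 exactly for i = 0; so the sum over nonzero residues is -1 or
   0. *)
rewrite big_ord_recl expr0n.
move=> /eqP; rewrite addrC addr_eq0 => /eqP ->.
by case: i ip => [|i] _ /=; rewrite ?invr1 ?mulr1 ?opprK // oppr0 mul0r oppr0.
Qed.

End SeriesModP.

(** * The Fleck quotient *)

Section FleckModP.
Variable p : nat.
Hypothesis p_prime : prime p.
Local Notation Fp := 'F_p.
Implicit Types (i j k n M : nat) (r : int).

Let p_gt0 : (0 < p)%N := prime_gt0 p_prime.
Let natp0 : p%:R = 0 :> Fp := pchar_Fp_0 p_prime.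

(** Neighbouring values are opposite, since they add up to binom(p, k+1), a multiple of p. *)
Lemma bin_predp k : (k < p)%N -> 'C(p.-1, k)%:R = (-1) ^+ k :> Fp.
Proof.
elim: k => [|k IHk] kp; first by rewrite bin0.
have : 'C(p.-1.+1, k.+1)%:R = 0 :> Fp.
  apply/eqP; rewrite prednK // -(dvdn_pcharf (pchar_Fp p_prime)).
  by rewrite prime_dvd_bin.
rewrite binS natrD IHk 1?ltnW // => /eqP; rewrite addr_eq0 => /eqP ->.
by rewrite exprS mulN1r.
Qed.

(** The integer v_k; the division is exact for k < p by [bin_predp]. *)
Definition bin_defect k : int := ((1 - (-1) ^+ k * 'C(p.-1, k)%:R) %/ p%:Z)%Z.

Lemma bin_defectP k : (k < p)%N ->
  'C(p.-1, k)%:R * (-1) ^+ k = 1 - p%:Z * bin_defect k.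
Proof.
move=> kp; rewrite mulrC (mulrC p%:Z) divzK; first by rewrite opprB addrC subrK.
rewrite (dvdz_pcharf (pchar_Fp p_prime)) rmorphB rmorphM rmorphXn rmorphN !rmorph1 /=.
by rewrite natz -pmulrn bin_predp // -expr2 sqrr_sign subrr.
Qed.

(** Hence v_k is harmonic modulo p. Over the integers, p (v_(k+1) - v_k) = (-1)^k binom(p, k+1), and
    (k+1) binom(p, k+1) = p binom(p-1, k); p is cancelled before reducing. *)
Lemma bin_defectS k : (k.+1 < p)%N ->
  k.+1%:R * ((bin_defect k.+1)%:~R - (bin_defect k)%:~R) = 1 :> Fp.
Proof.
move=> kp; have kp' := ltnW kp.
have pz0 : p%:Z != 0 by rewrite -lt0n.
have : k.+1%:R * (bin_defect k.+1 - bin_defect k) = 'C(p.-1, k)%:R * (-1) ^+ k :> int.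
  apply: (mulfI pz0); have [E1 E2] := (bin_defectP kp, bin_defectP kp').
  transitivity (k.+1%:R * ('C(p.-1, k)%:R * (-1) ^+ k - 'C(p.-1, k.+1)%:R * (-1) ^+ k.+1) : int).
    by rewrite E1 E2; ring.
  have Cp : p%:Z * 'C(p.-1, k)%:R = k.+1%:R * ('C(p.-1, k)%:R + 'C(p.-1, k.+1)%:R) :> int.
    rewrite -[p%:Z]natz -natrM -natrD -natrM mul_bin_diag -[in LHS](prednK p_gt0).
    by rewrite binS addnC.
  by rewrite exprS [RHS]mulrA Cp; ring.
move/(congr1 (fun a => a%:~R : Fp)); rewrite !rmorphM rmorphB /= rmorphXn rmorphN rmorph1 /=.
by rewrite !natz -!pmulrn bin_predp // -expr2 sqrr_sign.
Qed.

Lemma fleck_sumE n r :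
  fleck_sum p n r = altsum n (fun k => (k%:Z == r %[mod p%:Z])%Z%:R).
Proof.
rewrite /fleck_sum big_mkcond; apply: eq_bigr => k _.
by case: (_ == _); rewrite ?mulr1 ?mulr0.
Qed.

Lemma fleck_sumS n r : fleck_sum p n.+1 r = fleck_sum p n r - fleck_sum p n (r - 1).
Proof.
rewrite !fleck_sumE altsumS; congr (_ - _); apply: eq_bigr => k _.
by rewrite -[in RHS](eqz_modDr 1) subrK -PoszD addn1.
Qed.

Lemma fleck_sumD M n r :
  fleck_sum p (M + n) r = altsum M (fun k => fleck_sum p n (r - k%:Z)).
Proof.
elim: M r => [|M IHM] r; first by rewrite /altsum big_ord1 !mul1r subr0.
rewrite addSn fleck_sumS altsumS !IHM; congr (_ - _); apply: eq_bigr => k _.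
by rewrite -addrA -opprD intS.
Qed.

(** By [fleck_sumS] the sum telescopes, and r - p is in the class of r. *)
Lemma sum_fleck_sum n r : \sum_(k < p) fleck_sum p n.+1 (r - k%:Z) = 0.
Proof.
have -> : \sum_(k < p) fleck_sum p n.+1 (r - k%:Z)
  = - \sum_(0 <= k < p) (fleck_sum p n (r - k.+1%:Z) - fleck_sum p n (r - k%:Z)).
  rewrite big_mkord -sumrN; apply: eq_bigr => k _.
  by rewrite fleck_sumS opprB -addrA -opprD intS (addrC 1).
rewrite (telescope_sumr (fun k => fleck_sum p n (r - k%:Z))) //.
suff -> : fleck_sum p n (r - p%:Z) = fleck_sum p n r by rewrite subr0 subrr oppr0.
by rewrite /fleck_sum -(modzDr (r - p%:Z)) subrK.
Qed.

(** In the (p-1)-th difference the coefficients are 1 - p v_k; the constant part contributes nothing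
    by [sum_fleck_sum], so a factor p comes out. *)
Lemma fleck_sum_step n r :
  fleck_sum p (p.-1 + n.+1) r
  = - p%:Z * \sum_(k < p) bin_defect k * fleck_sum p n.+1 (r - k%:Z).
Proof.
rewrite fleck_sumD /altsum prednK //.
under eq_bigr => k _ do rewrite bin_defectP // mulrBl mul1r.
rewrite sumrB sum_fleck_sum sub0r mulNr mulr_sumr; congr (- _).
by apply: eq_bigr => k _; rewrite mulrA.
Qed.

(** Adding p - 1 to the index raises the floor by one, which absorbs the factor -p. *)
Lemma fleck_quotient_step n r :
  fleck_quotient p (p.-1 + n.+1) r
  = \sum_(k < p) (bin_defect k)%:~R * fleck_quotient p n.+1 (r - k%:Z).
Proof.
have p10 : p%:Z - 1 != 0 by rewrite subr_eq0 eqz_nat neq_ltn prime_gt1 ?orbT.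
have pp10 : - p%:R != 0 :> rat by rewrite oppr_eq0 pnatr_eq0 -lt0n.
have -> : fleck_quotient p (p.-1 + n.+1) r
          = (- p%:R) ^ (- ((n.+1%:Z - 1) %/ (p%:Z - 1))%Z - 1)
            * (fleck_sum p (p.-1 + n.+1) r)%:~R.
  rewrite /fleck_quotient addnS addr0; congr (_ ^ _ * _).
  rewrite -opprD; congr (- _).
  have -> : (p.-1 + n).+1%:Z - 1 = (p%:Z - 1) + (n.+1%:Z - 1).
    by rewrite -{2}(prednK p_gt0) !intS PoszD; ring.
  by rewrite divzDl ?dvdzz // divzz p10 addrC.
rewrite fleck_sum_step expfzDr // exprN1 rmorphM rmorphN /= -pmulrn mulrA mulfVK //.
rewrite rmorph_sum mulr_sumr; apply: eq_bigr => k _.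
by rewrite /fleck_quotient addr0 rmorphM /= mulrCA.
Qed.
End FleckModP.

(** * Least residues of -n *)

Lemma lres_lt (a : int) m : (0 < m)%N -> (lres a m < m)%N.
Proof. by move=> m0; rewrite -ltz_nat gez0_abs ?modz_ge0 ?ltz_pmod // -lt0n. Qed.

Lemma lres_oppD m n : lres (- (m + n)%N%:Z) m = lres (- n%:Z) m.
Proof. by rewrite /lres PoszD opprD addrC -[in RHS](subrK m%:Z (- n%:Z)) modzDr. Qed.

Lemma lres_opp_small m n : (0 < n <= m)%N -> lres (- n%:Z) m = (m - n)%N.
Proof.
move=> /andP[n0 nm]; rewrite /lres -(modzDr (- n%:Z)) addrC subzn // modz_nat absz_nat.
by rewrite modn_small // ltn_subrL n0 (leq_trans n0 nm).
Qed.

Lemma dvdn_add_lres m n : (0 < m)%N -> (m %| n + lres (- n%:Z) m)%N.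
Proof.
move=> m0; rewrite -[(_ %| _)%N]/(m%:Z %| (n + lres (- n%:Z) m)%:Z)%Z.
rewrite PoszD gez0_abs ?modz_ge0 -?lt0n //.
by rewrite addrC -[X in _ + X]opprK -eqz_mod_dvd modz_mod.
Qed.

(** * The Fleck quotient as a series coefficient modulo p *)

Section FleckQuotientModP.
Variable p : nat.
Hypothesis p_prime : prime p.
Local Notation Fp := 'F_p.
Local Notation D := (expm1_divx_poly Fp p).
Local Notation E := (@exp_poly Fp p).
Implicit Types (t : Fp) (i j k n M : nat) (r : int).

Let p_gt0 : (0 < p)%N := prime_gt0 p_prime.

Lemma fermat_Fp (x : Fp) : x ^+ p.-1 = (x != 0)%:R.
Proof.
have [->|x0] := eqVneq x 0.
  by rewrite expr0n -subn1 subn_eq0 leqNgt prime_gt1.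
apply: (mulfI x0); rewrite -exprS prednK // mulr1.
by have := expf_card x; rewrite card_Fp.
Qed.

Lemma signr_predp : (-1) ^+ p.-1 = 1 :> Fp.
Proof. by rewrite fermat_Fp oppr_eq0 oner_neq0. Qed.

Lemma wilson_Fp : p.-1`!%:R = -1 :> Fp.
Proof.
apply/eqP; rewrite -subr_eq0 opprK natr1 -(dvdn_pcharf (pchar_Fp p_prime)).
by rewrite -Wilson // prime_gt1.
Qed.

(** Wilson's theorem with (p-1)! = binom(p-1, j) j! (p-1-j)! and [bin_predp]. *)
Lemma wilson_Fp_fact j : (j < p)%N ->
  (-1) ^+ j / j`!%:R = - (p.-1 - j)`!%:R :> Fp.
Proof.
move=> jp; have jp' : (j <= p.-1)%N by rewrite -ltnS prednK.
have := wilson_Fp; rewrite -(bin_fact jp') !natrM bin_predp // => W.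
have j0 := fact_Fp_neq0 p_prime jp; apply: (mulIf j0); rewrite mulfVK //.
move: W (sqrr_sign Fp j); rewrite expr2.
move: ((-1) ^+ j) (j`!%:R : Fp) ((p.-1 - j)`!%:R : Fp) => s a b W s2.
transitivity (- s * (s * (a * b))); first by rewrite W; ring.
by rewrite mulrA mulNr s2; ring.
Qed.

Lemma fleck_quotient_small n r : (0 < n < p)%N ->
  fleck_quotient p n r = (fleck_sum p n r)%:~R.
Proof.
case: n => // n /andP[_ np]; rewrite /fleck_quotient addr0 intS addrAC subrr add0r.
have -> : p%:Z - 1 = p.-1%:Z by rewrite -{1}(prednK p_gt0) intS addrAC subrr add0r.
by rewrite divz_nat divn_small ?oppr0 ?expr0z ?mul1r // -ltnS prednK.
Qed.

(** With j = p - 1 - n the exponent in [expm1_pow_expE] is p - 1, so Fermat's theorem turns the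
    powers into indicators of k different from r. *)
Lemma fleck_sum_Fp n r : (0 < n < p)%N ->
  (fleck_sum p n r)%:~R
  = (-1) ^+ n * expm1_pow_exp n (- r%:~R : Fp) (p.-1 - n).
Proof.
move=> /andP[n0 np]; have np' : (n <= p.-1)%N by rewrite -ltnS prednK.
rewrite expm1_pow_expE ?subnKC ?fact_predp_neq0 //.
rewrite (sum_signed_binom n (fun k => (k%:R + - r%:~R) ^+ p.-1 / p.-1`!%:R)).
rewrite mulrA -expr2 sqrr_sign mul1r fleck_sumE /altsum rmorph_sum /=.
(* Adding this zero sum, available as n > 0, turns -(k - r)^(p-1) into 1 - (k - r)^(p-1). *)
have C0 : \sum_(k < n.+1) 'C(n, k)%:R * (-1) ^+ k = 0 :> Fp.
  have := exprDn (1 : Fp) (-1) n; rewrite subrr expr0n eqn0Ngt n0 mulr0n => S0; rewrite [RHS]S0.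
  by apply: eq_bigr => k _; rewrite expr1n mul1r mulr_natl.
rewrite -[RHS]addr0 -[X in _ + X]C0 -big_split /=.
apply: eq_bigr => k _; rewrite fermat_Fp wilson_Fp invrN1 subr_eq0.
rewrite !rmorphM rmorphXn rmorphN rmorph1 /= natz -pmulrn.
rewrite -subr_eq0 -[k%:R]/(k%:Z%:~R) -rmorphB -(dvdz_pcharf (pchar_Fp p_prime)).
rewrite -eqz_mod_dvd.
by case: (_ == _) => /=; ring.
Qed.

Lemma reduces_fleck_quotient n r :
  reduces (fleck_quotient p n r)
    ((-1) ^+ n * expm1_pow_exp n (- r%:~R : Fp) (lres (- n%:Z) p.-1)).
Proof.
have p10 : (0 < p.-1)%N by rewrite -ltnS prednK // prime_gt1.
case: n => [|n].
  have -> : lres (- 0) p.-1 = 0%N by rewrite /lres oppr0 mod0z.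
  rewrite expr0 mul1r /expm1_pow_exp /fps_mul big_ord1 /exp_coef expr0 invr1 !mulr1.
  rewrite /fleck_quotient sub0r.
  (* At n = 0 the floor is -1, so the Fleck sum carries a factor -p and only the correction term 1
     remains modulo p. *)
  have -> : (- (-1 %/ (p%:Z - 1))%Z) = 1.
    have -> : p%:Z - 1 = p.-1%:Z by rewrite -{1}(prednK p_gt0) intS addrAC subrr add0r.
    by rewrite (divNz_nat 0 p10) div0n opprK.
  rewrite expr1z -[X in reduces _ X]add0r; apply: reducesD; last exact: (reduces_nat _ 1).
  rewrite -(mul0r (fleck_sum p 0 r)%:~R); apply: reducesM; last exact: reduces_int.
  by have := reducesN (reduces_nat p p); rewrite pchar_Fp_0 // oppr0.
(* Strong induction: the recursion steps back by p - 1. *)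
elim: n.+1 {-2}n (leqnn n.+1) r => // {}n IHn m mn r.
have [mp|pm] := ltnP m.+1 p.
  rewrite fleck_quotient_small // lres_opp_small -?fleck_sum_Fp //.
    exact: reduces_int.
  by rewrite /= -ltnS prednK.
have Em : m.+1 = (p.-1 + (m.+1 - p).+1)%N by rewrite addnS -addSn prednK ?subnKC.
set m' := (m.+1 - p)%N in Em.
rewrite Em fleck_quotient_step // lres_oppD; set ns := lres _ _.
have ns_lt : (ns < p.-1)%N by apply: lres_lt.
have ns_p : (ns < p)%N by apply: leq_trans ns_lt (leq_pred p).
have -> : (-1) ^+ (p.-1 + m'.+1) * expm1_pow_exp (p.-1 + m'.+1) (- r%:~R : Fp) ns
  = \sum_(k < p) (bin_defect p k)%:~R
      * ((-1) ^+ m'.+1 * expm1_pow_exp m'.+1 (- (r - k%:Z)%:~R : Fp) ns).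
  rewrite exprD signr_predp mul1r; under eq_bigr do rewrite mulrCA.
  rewrite -mulr_sumr; congr (_ * _); rewrite (expm1_pow_exp_coef _ _ ns_p).
  (* The harmonic series V satisfies D V = 1 modulo X^(p-1); with D^p = 1 it acts as [D ^+ p.-1].
     Since ns < p - 1, this precision suffices. *)
  transitivity (D ^+ m'.+1 * E (- r%:~R) * \sum_(k < p) (bin_defect p k)%:~R *: E k%:R)`_ns.
    set V := \sum_(k < p) _.
    have DV : eqX p.-1 (D * V) 1.
      apply: (mul_expm1_divx_harmonic p_prime (v := fun k => (bin_defect p k)%:~R)).
        by rewrite /bin_defect bin0 mulr1 subrr div0z.
      by move=> k kp; apply: bin_defectS.
    transitivity (D ^+ (p.-1 + m'.+1) * E (- r%:~R) * (D * V))`_ns.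
      by rewrite (eqXM (@eqX_refl _ _ _) DV) ?mulr1.
    have -> : D ^+ (p.-1 + m'.+1) * E (- r%:~R) * (D * V)
              = D ^+ (p + m'.+1) * (E (- r%:~R) * V).
      have -> : (p + m'.+1 = (p.-1 + m'.+1).+1)%N by rewrite -addSn prednK.
      by rewrite exprS; ring.
    have DE : eqX p (D ^+ (p + m'.+1)) (D ^+ m'.+1).
      by apply: expm1_divx_exp_mod; rewrite ?modnDl.
    by rewrite (eqXM DE (@eqX_refl _ _ _)) // mulrA.
  rewrite mulr_sumr coef_sum; apply: eq_bigr => k _.
  rewrite -scalerAr coefZ (expm1_pow_exp_coef _ _ ns_p) -mulrA.
  rewrite (eqXM (@eqX_refl _ _ _) (exp_polyM _ _ (fact_predp_neq0 p_prime))) //.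
  by rewrite rmorphB opprB addrC.
apply: (rel_sum (P := @reduces p) (reduces_nat p 0) (@reducesD p) (n := p)
  (f := fun k => (bin_defect p k)%:~R * fleck_quotient p m'.+1 (r - k%:Z))
  (g := fun k => (bin_defect p k)%:~R * (_ * expm1_pow_exp _ (- (r - k%:Z)%:~R) ns))) => k kp.
apply: reducesM; first exact: reduces_int.
by apply: IHn; rewrite -ltnS; apply: leq_trans mn; rewrite Em -add1n leq_add2r.
Qed.

End FleckQuotientModP.

(** * Negative powers of (e^x - 1)/x modulo p *)

Section BernoulliModP.
Variable p : nat.
Hypothesis p_prime : prime p.
Local Notation Fp := 'F_p.
Local Notation D := (expm1_divx_poly Fp p).
Implicit Types (t : Fp) (j n M : nat).

Let p_gt0 : (0 < p)%N := prime_gt0 p_prime.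

(** The error of the truncated geometric series is (1 - D)^p, a multiple of X^p. *)
Lemma expm1_divx_inv : eqX p (D * \sum_(j < p) (1 - D) ^+ j) 1.
Proof.
move=> i ip; have := subrX1 (1 - D) p; rewrite addrAC subrr add0r mulNr => DU.
rewrite -[D * _]opprK -DU opprB coefB coef_exp_small ?subr0 //.
by rewrite coefB coef1 coef_poly p_gt0 /expm1_divx_coef invr1 subrr.
Qed.

(** D^(-M) = D^n because D^(n+M) is a power of D^p = 1. *)
Lemma fps_inv_pow_expm1 n M t j : (p %| n + M)%N -> (j < p)%N ->
  fps_mul (fps_pow (fps_inv (@expm1_divx_coef Fp)) M) (exp_coef t) j
  = expm1_pow_exp n t j.
Proof.
move=> /dvdnP[q nM] jp; rewrite (expm1_pow_exp_coef _ _ jp).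
set U := \sum_(j < p) (1 - D) ^+ j.
have Dcoef k : (k < p)%N -> D`_k = expm1_divx_coef Fp k by move=> kp; rewrite coef_poly kp.
have D0 : D`_0 = 1 by rewrite Dcoef // /expm1_divx_coef invr1.
rewrite (@fps_mul_coef _ p (U ^+ M) (exp_poly p t)) //; first last.
- by move=> k kp; rewrite coef_poly kp.
- move=> k kp; apply: esym; apply: (fps_pow_coef (N := p)) kp => l lp.
  by rewrite (fps_inv_coef Dcoef D0).
have DUM : eqX p ((D * U) ^+ M) 1.
  by rewrite -(expr1n _ M); apply/eqXE/expm1_divx_inv.
transitivity (D ^+ n * exp_poly p t * (D * U) ^+ M)`_j; last first.
  by rewrite (eqXM (@eqX_refl _ _ _) DUM) ?mulr1.
have -> : D ^+ n * exp_poly p t * (D * U) ^+ M = D ^+ (p * q) * (U ^+ M * exp_poly p t).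
  by rewrite mulnC -nM exprD exprMn; ring.
by rewrite (eqXM (@expm1_divx_exp_muln p p_prime q) (@eqX_refl _ _ _)) ?mul1r.
Qed.

End BernoulliModP.

Theorem theorem1p2 (p n : nat) (r m : int) (p_prime : prime p)
    (m_n : (m = n%:Z %[mod p%:Z])%Z) :
  let ns := lres (- n%:Z) p.-1 in
  (0 <= m ->
   let M := `|m|%N in
   [/\ \sum_(k < ns.+1)
          nstirling2 (ns - k + M) M * ((- r%:~R) ^+ k / k`!%:R)
       = \sum_(k < ns.+1) nstirling2 (M + ns) (M + k) * binom (- r%:~R) k,
       \sum_(k < ns.+1) nstirling2 (M + ns) (M + k) * binom (- r%:~R) k
       = \sum_(k < M.+1) 'C(M, k)%:R * (-1) ^+ (M - k)
           * ((k%:R - r%:~R) ^+ (M + ns) / (M + ns)`!%:R)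
     & congr_mod p ((-1) ^+ n * fleck_quotient p n r)
         (\sum_(k < ns.+1)
            nstirling2 (ns - k + M) M * ((- r%:~R) ^+ k / k`!%:R))])
  /\
  (m <= 0 ->
   let M := `|m|%N in
   congr_mod p (fleck_quotient p n r)
     ((-1) ^+ ns / ns`!%:R * (bernoulli_poly M ns).[- r%:~R])
   /\ congr_mod p ((-1) ^+ ns / ns`!%:R * (bernoulli_poly M ns).[- r%:~R])
        (- (p - 1 - ns)`!%:R * (bernoulli_poly M ns).[- r%:~R])).
Proof.
have p10 : (0 < p.-1)%N by rewrite -ltnS prednK ?prime_gt1 ?prime_gt0.
move=> ns; have ns_lt : (ns < p.-1)%N by apply: lres_lt.
have ns_p : (ns < p)%N by apply: leq_trans ns_lt (leq_pred p).
have red_r : reduces (- r%:~R) (- r%:~R : 'F_p) by apply/reducesN/reduces_int.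
have red_sign k : reduces ((-1) ^+ k) ((-1) ^+ k : 'F_p).
  exact/reducesX/reducesN/(reduces_nat _ 1).
have red_fleck := reduces_fleck_quotient p_prime n r; split=> [m_ge0 | m_le0] M.
  have Mn : M = n %[mod p].
    by apply/eqP; rewrite -eqz_nat -!modz_nat gez0_abs // m_n.
  split.
  - by rewrite -expm1_pow_exp_stirling2_exp -expm1_pow_exp_stirling2_binom.
  - by rewrite -expm1_pow_exp_stirling2_binom expm1_pow_expE ?natr_fact_neq0.
  rewrite -expm1_pow_exp_stirling2_exp.
  apply: (congr_mod_reduces p_prime _ (reduces_expm1_pow_exp p_prime M red_r ns_lt)).
  rewrite (expm1_pow_exp_mod p_prime _ Mn ns_p).
  have -> : expm1_pow_exp n (- r%:~R : 'F_p) ns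
            = (-1) ^+ n * ((-1) ^+ n * expm1_pow_exp n (- r%:~R) ns).
    by rewrite mulrA -expr2 sqrr_sign mul1r.
  exact: reducesM.
have p_nM : (p %| n + M)%N.
  have : (p%:Z %| n%:Z - m)%Z by rewrite -eqz_mod_dvd m_n.
  by rewrite -(lez0_abs m_le0).
have red_bern := reduces_bernoulli_poly p_prime M red_r ns_lt.
rewrite (fps_inv_pow_expm1 p_prime _ p_nM ns_p) in red_bern.
(* p - 1 divides n + ns, and (-1)^(p-1) = 1 in F_p even for p = 2. *)
have sign_ns : (-1) ^+ n = (-1) ^+ ns :> 'F_p.
  have /dvdnP[q nq] : (p.-1 %| n + ns)%N by apply: dvdn_add_lres.
  have : (-1) ^+ (n + ns) = 1 :> 'F_p by rewrite nq mulnC exprM signr_predp ?expr1n.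
  rewrite exprD => nns; rewrite -[RHS]mul1r -[X in X * _]nns.
  by rewrite -mulrA -expr2 sqrr_sign mulr1.
have ns0 := fact_Fp_neq0 p_prime ns_p.
have red_mid : reduces ((-1) ^+ ns / ns`!%:R * (bernoulli_poly M ns).[- r%:~R])
  ((-1) ^+ n * expm1_pow_exp n (- r%:~R : 'F_p) ns).
  (* Inserts ns!^(-1) ns!, since the residue of the Bernoulli value is ns! times the series
     coefficient. *)
  rewrite sign_ns -(mulKf ns0 (expm1_pow_exp _ _ _)) mulrA.
  by apply: reducesM => //; apply: reducesM => //; apply: reduces_factV.
split; first exact (congr_mod_reduces p_prime red_fleck red_mid).
apply: (congr_mod_reduces p_prime red_mid).
rewrite sign_ns -(mulKf ns0 (expm1_pow_exp _ _ _)) mulrA wilson_Fp_fact //.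
by rewrite subn1; apply: reducesM => //; apply: reducesN; apply: reduces_nat.
Qed.
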